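(* Let $K$ be a field of characteristic $0$, let $E=\bigsqcup_{i\ge 1}E_i$ be a non-empty graded set, let $(\mathcal T^E,\to)$ be the pre-Lie algebra of non-planar $E$-decorated rooted trees with grafting, and let $\Phi:(\mathcal T^E,\to)\to(\mathcal L(E),\rhd)$ be the unique pre-Lie algebra homomorphism which sends the one-vertex tree decorated by $a$ to $a$, for every $a\in E$. Let $I$ be the two-sided ideal of $(\mathcal T^E,\to)$ generated by all elements $|s|(s\to t)+|t|(t\to s)$, where $s,t$ are trees in $T^E$. Then $I=\operatorname{Ker}\Phi$.
   Context: $E_i$ is the finite set of generators of degree $i$. $T^E$ is the set of non-planar rooted trees with vertices decorated by elements of $E$, and $\mathcal T^E$ its $K$-linear span. The degree of a tree $t$ with decoration $d:V(t)\to E$ is $|t|=\sum_{v\in V(t)}|d(v)|$. Grafting is the bilinear product $s\to t=\sum_{v\in V(t)}s\to_v t$, where $s\to_v t$ is the tree obtained by joining the root of $s$ by a new edge to the vertex $v$ of $t$ (so that $v$ becomes the parent of the root of $s$). With this product $\mathcal T^E$ is the free (left) pre-Lie algebra generated by the one-vertex trees (identified with $E$). The left pre-Lie identity is $(x\rhd y)\rhd z-x\rhd(y\rhd z)=(y\rhd x)\rhd z-y\rhd(x\rhd z)$. $\mathcal L(E)=\bigoplus_{i\ge1}\mathcal L_i$ is the free Lie algebra over $K$ generated by $E$, graded by the degrees of the generators, endowed with the pre-Lie product $x\rhd y=\frac1{|x|}[x,y]$ for $x$ homogeneous of degree $|x|$, extended bilinearly. *)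

(* Defs.v *)
From HB Require Import structures.
From mathcomp Require Import all_boot all_order all_algebra.
From mathcomp Require Import finmap generic_quotient boolp.
From mathcomp.multinomials Require Import monalg.

Set Implicit Arguments.
Unset Strict Implicit.
Unset Printing Implicit Defensive.

Import GRing.Theory.
Local Open Scope ring_scope.
Local Open Scope quotient_scope.

(** A non-planar tree is an isomorphism class of planar trees, two planar trees
    being isomorphic when they differ by permutations of the children of
    their vertices. *)

Inductive ptree (E : Type) : Type := PNode of E & seq (ptree E).

Section PtreeChoice.
Variable E : Type.

Lemma ptree_nested_ind (P : ptree E -> Prop) :
    (forall a l, foldr (fun t Q => P t /\ Q) True l -> P (PNode a l)) ->
  forall t, P t.
Proof.
move=> H.
exact: (fix IH t : P t := let: PNode a l := t in H a l
  ((fix IHl m : foldr (fun t Q => P t /\ Q) True m :=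
    match m with [::] => I | u :: m' => conj (IH u) (IHl m') end) l)).
Qed.

Fixpoint ptree_encode (t : ptree E) : GenTree.tree E :=
  let: PNode a l := t in GenTree.Node 0 (GenTree.Leaf a :: map ptree_encode l).

Fixpoint ptree_decode (g : GenTree.tree E) : option (ptree E) :=
  match g with
  | GenTree.Node _ (GenTree.Leaf a :: l) => Some (PNode a (pmap ptree_decode l))
  | _ => None
  end.

Lemma ptree_codeK : pcancel ptree_encode ptree_decode.
Proof.
elim/ptree_nested_ind => a l IH /=; congr (Some (PNode a _)).
by elim: l IH => //= t l IHl [-> /IHl ->].
Qed.
End PtreeChoice.

HB.instance Definition _ (E : eqType) :=
  Equality.copy (ptree E) (pcan_type (@ptree_codeK E)).
HB.instance Definition _ (E : choiceType) :=
  Choice.copy (ptree E) (pcan_type (@ptree_codeK E)).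

Section PlanarTrees.
Variable E : eqType.
Implicit Types (s t u : ptree E) (l m : seq (ptree E)).

Lemma ptree_ind_mem (P : ptree E -> Prop) :
  (forall a l, {in l, forall t, P t} -> P (PNode a l)) -> forall t, P t.
Proof.
move=> H; elim/ptree_nested_ind => a l IH; apply: H.
elim: l IH => //= t l IHl [Pt /IHl Pl] u.
by rewrite inE => /predU1P[->|/Pl].
Qed.

Fixpoint ptree_iso s t {struct s} : bool :=
  match s, t with PNode a l, PNode b m =>
    (a == b) && has (fun m' => all2 ptree_iso l m') (permutations m)
  end.

(** The vertices of a planar tree, as addresses: the root is [::], and i :: v
    is the vertex v of the subtree at the i-th child of the root. *)
Fixpoint pvertices t : seq (seq nat) :=
  let: PNode _ l := t in
  [::] :: flatten [seq [seq p.1 :: v | v <- p.2]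
                  | p <- zip (iota 0 (size l)) (map pvertices l)].

(** Joins the root of [s] by a new edge to the vertex [v] of [t], so that [s]
    becomes one of the subtrees hanging from [v]. *)
Fixpoint pgraft_at s (v : seq nat) t : ptree E :=
  match v, t with
  | [::], PNode a l => PNode a (s :: l)
  | i :: v', PNode a l =>
      PNode a (set_nth t l i (pgraft_at s v' (nth t l i)))
  end.

Fixpoint pdegree (deg : E -> nat) t : nat :=
  let: PNode a l := t in (deg a + sumn (map (pdegree deg) l))%N.

Lemma ptree_isoP a l b m :
  reflect (a = b /\ exists2 m', perm_eq m' m & all2 ptree_iso l m')
          (ptree_iso (PNode a l) (PNode b m)).
Proof.
apply: (iffP andP) => [[/eqP-> /hasP[m' m'P ?]]|[-> [m' m'P ?]]]; split=> //.
  by exists m'; rewrite // -mem_permutations.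
by apply/hasP; exists m'; rewrite // mem_permutations.
Qed.

Lemma all2_nthP (x : ptree E) (r : rel (ptree E)) l m :
  reflect (size l = size m /\
           forall i, (i < size l)%N -> r (nth x l i) (nth x m i))
          (all2 r l m).
Proof.
elim: l m => [|y l IH] [|z m] /=.
- exact: ReflectT.
- by apply: ReflectF; case.
- by apply: ReflectF; case.
apply: (iffP andP) => [[ryz /IH[-> H]]|[sz H]].
  by split=> // -[|i] // im; apply: H.
by split; [exact: (H 0%N)|apply/IH; split=> [|i im]; [case: sz|exact: (H i.+1)]].
Qed.

Lemma all2_perm (r : rel (ptree E)) l m m' :
  perm_eq m m' -> all2 r l m -> exists2 l', perm_eq l' l & all2 r l' m'.
Proof.
case: l => [|x l0]; last set l := x :: l0.
  case: m => [|y m0] // + _; rewrite perm_sym => /perm_nilP->.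
  by exists [::].
rewrite perm_sym => /(perm_iotaP x)[Is pIs ->] /(all2_nthP x)[sz H].
have szIs : size Is = size m by rewrite (perm_size pIs) size_iota.
exists (map (nth x l) Is); first by apply/(perm_iotaP x); exists Is; rewrite ?sz.
apply/(all2_nthP x); rewrite !size_map; split=> // i ltiI.
rewrite !(nth_map 0%N) //; apply: H.
have : nth 0%N Is i \in Is by rewrite mem_nth.
by rewrite (perm_mem pIs) mem_iota sz.
Qed.

Lemma all2_flip (r : rel (ptree E)) l m :
  all2 r l m = all2 (fun x y => r y x) m l.
Proof. by elim: l m => [|x l IH] [|y m] //=; rewrite IH. Qed.

Lemma ptree_iso_refl : reflexive ptree_iso.
Proof.
elim/ptree_ind_mem => a l IH; apply/ptree_isoP; split=> //; exists l => //.
apply/(all2_nthP (PNode a l)); split=> // i il.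
by apply: IH; rewrite mem_nth.
Qed.

Lemma ptree_iso_sym_imp s t : ptree_iso s t -> ptree_iso t s.
Proof.
elim/ptree_ind_mem: s t => a l IH [b m] /ptree_isoP[<- [m' pm lm']].
apply/ptree_isoP; split=> //.
have [l' pl l'm] := all2_perm pm lm'; exists l' => //.
move/(all2_nthP (PNode a l)): l'm => [sz H].
apply/(all2_nthP (PNode a l)); split=> // i im; apply: IH; last first.
  by apply: H; rewrite sz.
by rewrite -(perm_mem pl) mem_nth // sz.
Qed.

Lemma ptree_iso_sym : symmetric ptree_iso.
Proof. by move=> s t; apply/idP/idP => /ptree_iso_sym_imp. Qed.

Lemma ptree_iso_trans : transitive ptree_iso.
Proof.
move=> t s u; elim/ptree_ind_mem: s t u => a l IH [b m] [c p].
move=> /ptree_isoP[<- [m' pm lm']] /ptree_isoP[<- [p' pp mp']].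
have [p'' pp'' mp''] : exists2 p'', perm_eq p'' p' & all2 ptree_iso m' p''.
  rewrite perm_sym in pm; rewrite all2_flip in mp'.
  by have [q ? qm'] := all2_perm pm mp'; exists q; rewrite // all2_flip.
apply/ptree_isoP; split=> //; exists p''; first exact: perm_trans pp'' pp.
move/(all2_nthP (PNode a l)): lm' => [sz1 H1].
move/(all2_nthP (PNode a l)): mp'' => [sz2 H2].
apply/(all2_nthP (PNode a l)); split=> [|i il]; first by rewrite sz1.
apply: (IH _ _ (nth (PNode a l) m' i)); rewrite ?mem_nth //; first exact: H1.
by apply: H2; rewrite -sz1.
Qed.

Canonical ptree_iso_equiv :=
  EquivRel ptree_iso ptree_iso_refl ptree_iso_sym ptree_iso_trans.

Lemma pdegree_iso deg s t : ptree_iso s t -> pdegree deg s = pdegree deg t.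
Proof.
elim/ptree_ind_mem: s t => a l IH [b m] /ptree_isoP[<- [m' pm lm']] /=.
congr (_ + _)%N; rewrite -(perm_sumn (perm_map _ pm)); congr sumn.
move/(all2_nthP (PNode a l)): lm' => [sz H].
apply: (@eq_from_nth _ 0%N); rewrite !size_map // => i il.
rewrite !(nth_map (PNode a l)) -?sz //.
by apply: IH; rewrite ?mem_nth //; apply: H.
Qed.

End PlanarTrees.

Section Trees.
Variable E : choiceType.

Definition tree : Type := {eq_quot (@ptree_iso E)}.
HB.instance Definition _ := Choice.on tree.
HB.instance Definition _ := EqQuotient.on tree.

Definition tree_vertex (a : E) : tree := \pi_tree (PNode a [::]).

Definition tree_degree (deg : E -> nat) (t : tree) : nat :=
  pdegree deg (repr t).

Lemma tree_eqP (s t : ptree E) :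
  reflect (\pi_tree s = \pi_tree t) (ptree_iso s t).
Proof. exact: (@eqmodP _ (ptree_iso_equiv E)). Qed.

Lemma tree_degree_pi deg (t : ptree E) :
  tree_degree deg (\pi_tree t) = pdegree deg t.
Proof. by apply/pdegree_iso/tree_eqP; rewrite reprK. Qed.

(** The family of all [s ->_v t], [v] a vertex of [t], does not depend on the
    planar representatives of [s] and [t]. *)
Lemma pgraft_iso (s s' t t' : ptree E) : ptree_iso s s' -> ptree_iso t t' ->
  perm_eq [seq \pi_tree (pgraft_at s v t) | v <- pvertices t]
          [seq \pi_tree (pgraft_at s' v t') | v <- pvertices t'].
Proof.
pose grafts s0 t0 := [seq \pi_tree (pgraft_at s0 v t0) | v <- pvertices t0].
have graftsE s0 a l : let t0 := PNode a l in grafts s0 t0 =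
    \pi_tree (PNode a (s0 :: l)) ::
    flatten [seq [seq \pi_tree (PNode a (set_nth t0 l i (repr c)))
                 | c <- grafts s0 (nth t0 l i)] | i <- iota 0 (size l)].
  move=> t0; rewrite /grafts {2}/t0 /=; congr cons.
  rewrite map_flatten; congr flatten; rewrite -map_comp.
  have -> : zip (iota 0 (size l)) (map (@pvertices E) l)
          = [seq (i, pvertices (nth t0 l i)) | i <- iota 0 (size l)].
    rewrite -{2}[l](mkseq_nth t0) /mkseq -map_comp.
    by elim: (iota _ _) => //= i r ->.
  rewrite -map_comp; apply/eq_in_map => i; rewrite mem_iota /= add0n => il.
  rewrite -!map_comp; apply: eq_map => v /=.
  apply/tree_eqP/ptree_isoP; split=> //.
  exists (set_nth t0 l i (repr (\pi_tree (pgraft_at s0 v (nth t0 l i))))) => //.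
  apply/(all2_nthP t0); rewrite !size_set_nth; split=> // j _.
  rewrite !nth_set_nth /=; case: eqP => _; last exact: ptree_iso_refl.
  by apply/tree_eqP; rewrite reprK.
move=> ss'; elim/ptree_ind_mem: t t' => a l IH [b m] tt'.
case/ptree_isoP: (tt') => ab; rewrite -{}ab in tt' * => -[m' pm lm'].
rewrite -![map _ _]/(grafts _ _) !graftsE.
set t := PNode a l; set t' := PNode a m.
have -> : \pi_tree (PNode a (s :: l)) = \pi_tree (PNode a (s' :: m)).
  apply/tree_eqP/ptree_isoP; split=> //; exists (s' :: m').
    by rewrite perm_cons.
  by rewrite /= ss'.
rewrite perm_cons.
have /(perm_iotaP t')[Is pIs m'E] := pm.
have /(all2_nthP t)[szlm H] := lm'.
have szm : size l = size m by rewrite szlm (perm_size pm).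
have szIs : size Is = size m by rewrite (perm_size pIs) size_iota.
apply: (@perm_trans _ (flatten
   [seq [seq \pi_tree (PNode a (set_nth t' m i (repr c)))
        | c <- grafts s' (nth t' m i)] | i <- Is])); last first.
  exact/perm_flatten/perm_map.
rewrite -[Is](mkseq_nth 0%N) /mkseq -map_comp szIs -szm.
have: {subset iota 0 (size l) <= iota 0 (size l)} by [].
elim: {1 3 4}(iota 0 (size l)) => //= i r IHr sub.
have il : (i < size l)%N.
  by have := sub i (mem_head _ _); rewrite mem_iota.
apply: perm_cat; last by apply: IHr => j jr; apply: sub; rewrite inE jr orbT.
have iI : (i < size Is)%N by rewrite szIs -szm.
have nm' : nth t m' i = nth t' m (nth 0%N Is i).
  by rewrite m'E (set_nth_default t') ?size_map // (nth_map 0%N).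
have IsM : (nth 0%N Is i < size m)%N.
  have : nth 0%N Is i \in Is by rewrite mem_nth.
  by rewrite (perm_mem pIs) mem_iota.
apply: (@perm_trans _ [seq \pi_tree (PNode a (set_nth t l i (repr c)))
        | c <- grafts s' (nth t' m (nth 0%N Is i))]).
  by apply: perm_map; apply: IH; [rewrite mem_nth|rewrite -nm'; apply: H].
match goal with |- is_true (perm_eq ?A ?B) => suff -> : A = B by [] end.
apply: eq_map => c.
apply/tree_eqP/ptree_isoP; split=> //.
exists [seq nth t' (set_nth t' m (nth 0%N Is i) (repr c)) j | j <- Is].
  apply/(perm_iotaP t'); exists Is => //; rewrite size_set_nth.
  by rewrite (maxn_idPr IsM).
apply/(all2_nthP t); rewrite size_set_nth size_map (maxn_idPr il) szIs -szm.
split=> // j jl; rewrite nth_set_nth (nth_map 0%N) ?szIs -?szm //=.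
rewrite nth_set_nth /= nth_uniq ?szIs -?szm //; last first.
  by rewrite (perm_uniq pIs) iota_uniq.
case: eqP => _; first exact: ptree_iso_refl.
by have := H j jl; rewrite m'E (nth_map 0%N) // szIs -szm.
Qed.

End Trees.

(* Unfolding these makes unification very slow. *)
#[local] Opaque mkmalgU fgzero fgadd fgopp fgscale.

HB.lock Definition lin_ext (K : fieldType) (B : choiceType) (V : lmodType K)
    (f : B -> V) (x : {malg K[B]}) : V :=
  \sum_(b <- msupp x) x@_b *: f b.

HB.lock Definition bilin_ext (K : fieldType) (B : choiceType) (V : lmodType K)
    (f : B -> B -> V) (x y : {malg K[B]}) : V :=
  lin_ext (fun b => lin_ext (f b) y) x.

Section LinearExtension.
Variables (K : fieldType) (B : choiceType).

Lemma malgZU (c : K) (b : B) : << c *g b >> = c *: << b >> :> {malg K[B]}.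
Proof. by apply/malgP => k; rewrite mcoeffZ !mcoeffU mulrnAr mulr1. Qed.

Lemma malg_ind (P : {malg K[B]} -> Prop) :
    P 0 -> (forall c b x, P x -> P (c *: << b >> + x)) -> forall x, P x.
Proof.
move=> P0 PD x; rewrite [x]monalgE.
elim: (enum_fset _) => [|b r IH]; first by rewrite big_nil.
by rewrite big_cons malgZU; apply: PD.
Qed.

Variables (V : lmodType K).
Implicit Types (f : B -> V).

Lemma lin_extEw f (D : {fset B}) x : (msupp x `<=` D)%fset ->
  lin_ext f x = \sum_(b <- D) x@_b *: f b.
Proof.
move=> sD; rewrite lin_ext.unlock (big_fset_incl _ sD) // => b _.
by rewrite -mcoeff_eq0 => /eqP->; rewrite scale0r.
Qed.

Fact lin_ext_is_linear f : linear (lin_ext f).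
Proof.
move=> c x y; pose D := (msupp x `|` msupp y `|` msupp (c *: x + y))%fset.
rewrite !(@lin_extEw f D) ?/D; try by
  apply/fsubsetP => b bD; rewrite !in_fsetU bD ?orbT.
rewrite scaler_sumr -big_split /=; apply: eq_bigr => b _.
by rewrite mcoeffD mcoeffZ scalerDl scalerA.
Qed.
HB.instance Definition _ f :=
  GRing.isLinear.Build K {malg K[B]} V _ (lin_ext f) (lin_ext_is_linear f).

Lemma lin_extU f b : lin_ext f << b >> = f b.
Proof.
by rewrite lin_ext.unlock msuppU oner_eq0 big_seq_fset1 mcoeffUU scale1r.
Qed.

Variable g : B -> B -> V.

Fact bilin_ext_is_linearl y : linear (bilin_ext g ^~ y).
Proof. by move=> c x x'; rewrite bilin_ext.unlock linearP. Qed.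

Fact bilin_ext_is_linearr x : linear (bilin_ext g x).
Proof.
move=> c y y'; rewrite bilin_ext.unlock !(@lin_extEw _ (msupp x)) //.
rewrite scaler_sumr -big_split /=; apply: eq_bigr => b _.
by rewrite linearP scalerDr !scalerA mulrC.
Qed.
HB.instance Definition _ x := GRing.isLinear.Build K {malg K[B]} V _
  (bilin_ext g x) (bilin_ext_is_linearr x).

Lemma bilin_extDl x x' y :
  bilin_ext g (x + x') y = bilin_ext g x y + bilin_ext g x' y.
Proof. by have := bilin_ext_is_linearl y 1 x x'; rewrite !scale1r. Qed.

Lemma bilin_ext0l y : bilin_ext g 0 y = 0.
Proof. by rewrite bilin_ext.unlock linear0. Qed.

Lemma bilin_extZl c x y : bilin_ext g (c *: x) y = c *: bilin_ext g x y.
Proof. by rewrite bilin_ext.unlock linearZ. Qed.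

Lemma bilin_extUU b b' : bilin_ext g << b >> << b' >> = g b b'.
Proof. by rewrite bilin_ext.unlock !lin_extU. Qed.

End LinearExtension.

Record submodule (K : pzRingType) (V : lmodType K) : Type := Submodule {
  in_sub :> V -> Prop;
  sub0 : in_sub 0;
  subD : forall x y, in_sub x -> in_sub y -> in_sub (x + y);
  subZ : forall c x, in_sub x -> in_sub (c *: x)
}.

Section LmodQuotient.
Variables (K : pzRingType) (V : lmodType K) (J : submodule V).
Implicit Types (x y z : V).

Definition lquot_rel x y := `[< J (x - y) >].

Lemma subN x : J x -> J (- x).
Proof. by rewrite -scaleN1r; apply: subZ. Qed.

Fact lquot_rel_refl : reflexive lquot_rel.
Proof. by move=> x; apply/asboolP; rewrite subrr; exact: sub0. Qed.

Fact lquot_rel_sym : symmetric lquot_rel.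
Proof.
by move=> x y; apply/asboolP/asboolP => /subN; rewrite opprB.
Qed.

Fact lquot_rel_trans : transitive lquot_rel.
Proof.
move=> y x z /asboolP Jxy /asboolP Jyz; apply/asboolP.
by rewrite -[x](subrK y) -addrA; apply: subD.
Qed.

Canonical lquot_equiv :=
  EquivRel lquot_rel lquot_rel_refl lquot_rel_sym lquot_rel_trans.

Definition lquot : Type := {eq_quot lquot_rel}.
HB.instance Definition _ := Choice.on lquot.
HB.instance Definition _ := EqQuotient.on lquot.

End LmodQuotient.

HB.lock Definition lpi (K : pzRingType) (V : lmodType K) (J : submodule V)
    (x : V) : lquot J := \pi_(lquot J) x.

Section LmodQuotientTheory.
Variables (K : pzRingType) (V : lmodType K) (J : submodule V).
Local Notation lquot := (lquot J).
Local Notation lpi := (@lpi K V J).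
Implicit Types (x y z : V).

Lemma lpi_eqP x y : lpi x = lpi y <-> J (x - y).
Proof.
rewrite lpi.unlock; split=> [/(@eqmodP _ (lquot_equiv J))/asboolP|Jxy] //.
exact/(@eqmodP _ (lquot_equiv J))/asboolP.
Qed.

Lemma lpiK (q : lquot) : lpi (repr q) = q.
Proof. by rewrite lpi.unlock; apply: reprK. Qed.

Lemma lpi_repr x : J (repr (lpi x) - x).
Proof. by apply/lpi_eqP; rewrite lpiK. Qed.

(* Locked, so that unification does not unfold a sum into a class. *)
Let add (p q : lquot) := locked (lpi (repr p + repr q)).
Let opp (p : lquot) := locked (lpi (- repr p)).
Let scale c (p : lquot) := locked (lpi (c *: repr p)).

Let pi_add x y : add (lpi x) (lpi y) = lpi (x + y).
Proof. by rewrite /add -lock; apply/lpi_eqP; rewrite opprD addrACA; apply: subD; apply: lpi_repr. Qed.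

Let pi_opp x : opp (lpi x) = lpi (- x).
Proof. by rewrite /opp -lock; apply/lpi_eqP; rewrite -opprD; apply/subN/lpi_repr. Qed.

Let pi_scale c x : scale c (lpi x) = lpi (c *: x).
Proof. by rewrite /scale -lock; apply/lpi_eqP; rewrite -scalerBr; apply/subZ/lpi_repr. Qed.

Fact lquot_addA : associative add.
Proof.
by move=> p q r; rewrite -[p]lpiK -[q]lpiK -[r]lpiK !pi_add addrA.
Qed.

Fact lquot_addC : commutative add.
Proof. by move=> p q; rewrite -[p]lpiK -[q]lpiK !pi_add addrC. Qed.

Fact lquot_add0 : left_id (lpi 0) add.
Proof. by move=> p; rewrite -[p]lpiK pi_add add0r. Qed.

Fact lquot_addN : left_inverse (lpi 0) opp add.
Proof. by move=> p; rewrite -[p]lpiK pi_opp pi_add addNr. Qed.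

HB.instance Definition _ := GRing.isZmodule.Build lquot
  lquot_addA lquot_addC lquot_add0 lquot_addN.

Fact lquot_scaleA a b (p : lquot) : scale a (scale b p) = scale (a * b) p.
Proof. by rewrite -[p]lpiK !pi_scale scalerA. Qed.

Fact lquot_scale1 : left_id 1 scale.
Proof. by move=> p; rewrite -[p]lpiK pi_scale scale1r. Qed.

Let piD x y : lpi x + lpi y = lpi (x + y).
Proof. exact: pi_add. Qed.

Fact lquot_scaleDr : right_distributive scale +%R.
Proof.
by move=> a p q; rewrite -[p]lpiK -[q]lpiK !(pi_scale, piD) scalerDr.
Qed.

Fact lquot_scaleDl (p : lquot) : {morph scale^~ p : a b / a + b}.
Proof. by move=> a b; rewrite -[p]lpiK !pi_scale piD scalerDl. Qed.

HB.instance Definition _ := GRing.Zmodule_isLmodule.Build K lquot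
  lquot_scaleA lquot_scale1 lquot_scaleDr lquot_scaleDl.

Fact lpi_is_linear : linear lpi.
Proof. by move=> c x y; rewrite -piD -pi_scale. Qed.
HB.instance Definition _ := GRing.isLinear.Build K V lquot _ lpi lpi_is_linear.

Lemma lpi_eq0 x : lpi x = 0 <-> J x.
Proof. by rewrite -(linear0 lpi) lpi_eqP subr0. Qed.

End LmodQuotientTheory.

Inductive ideal_gen (K : pzRingType) (A : lmodType K) (mul : A -> A -> A)
    (G : A -> Prop) : A -> Prop :=
| IdealGen x of G x : ideal_gen mul G x
| Ideal0 : ideal_gen mul G 0
| IdealD x y of ideal_gen mul G x & ideal_gen mul G y : ideal_gen mul G (x + y)
| IdealZ c x of ideal_gen mul G x : ideal_gen mul G (c *: x)
| IdealMl a x of ideal_gen mul G x : ideal_gen mul G (mul a x)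
| IdealMr a x of ideal_gen mul G x : ideal_gen mul G (mul x a).

Definition ideal_sub (K : pzRingType) (A : lmodType K) (mul : A -> A -> A)
    (G : A -> Prop) : submodule A :=
  Submodule (Ideal0 mul G) (@IdealD K A mul G) (@IdealZ K A mul G).

Section Grafting.
Variables (K : fieldType) (E : choiceType).

(** The sum of the [s ->_v t] over the vertices [v] of [t]: the tree [s] is
    attached to [t]. The choice of representatives is irrelevant, by
    [tree_graft_pi]. *)
Definition tree_graft (s t : tree E) : {malg K[tree E]} :=
  \sum_(v <- pvertices (repr t))
     << \pi_(tree E) (pgraft_at (repr s) v (repr t)) >>.

Lemma tree_graft_pi (s t : ptree E) :
  tree_graft (\pi_(tree E) s) (\pi_(tree E) t) =
  \sum_(v <- pvertices t) << \pi_(tree E) (pgraft_at s v t) >>.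
Proof.
rewrite /tree_graft.
pose h (u v : ptree E) w := \pi_(tree E) (pgraft_at u w v).
rewrite -(big_map (h (repr (\pi s)) (repr (\pi t))) xpredT (fun u => << u >>)).
rewrite -(big_map (h s t) xpredT (fun u => << u >>)).
by apply/perm_big/pgraft_iso; apply/tree_eqP; rewrite reprK.
Qed.

Definition graft : {malg K[tree E]} -> {malg K[tree E]} -> {malg K[tree E]} :=
  bilin_ext tree_graft.

Definition symm_rel (deg : E -> nat) (x : {malg K[tree E]}) : Prop :=
  exists s t : tree E,
    x = (tree_degree deg s)%:R *: graft << s >> << t >>
      + (tree_degree deg t)%:R *: graft << t >> << s >>.

End Grafting.

(** The free Lie algebra is the quotient of the free nonassociative algebra on
    [E] (the space spanned by the free magma) by the ideal generated by the
    squares [x x] and the Jacobi relations. *)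

Inductive magma (E : Type) : Type :=
| MVar of E
| MMul of magma E & magma E.

Section MagmaChoice.
Variable E : Type.

Fixpoint magma_encode (u : magma E) : GenTree.tree E :=
  match u with
  | MVar a => GenTree.Leaf a
  | MMul u v => GenTree.Node 0 [:: magma_encode u; magma_encode v]
  end.

Fixpoint magma_decode (g : GenTree.tree E) : option (magma E) :=
  match g with
  | GenTree.Leaf a => Some (MVar a)
  | GenTree.Node _ [:: g; h] =>
      if (magma_decode g, magma_decode h) is (Some u, Some v)
      then Some (MMul u v) else None
  | _ => None
  end.

Lemma magma_codeK : pcancel magma_encode magma_decode.
Proof. by elim=> //= u -> v ->. Qed.

Fixpoint magma_degree (deg : E -> nat) (u : magma E) : nat :=
  match u with
  | MVar a => deg a
  | MMul u v => (magma_degree deg u + magma_degree deg v)%N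
  end.
End MagmaChoice.

HB.instance Definition _ (E : eqType) :=
  Equality.copy (magma E) (pcan_type (@magma_codeK E)).
HB.instance Definition _ (E : choiceType) :=
  Choice.copy (magma E) (pcan_type (@magma_codeK E)).

Section FreeLie.
Variables (K : fieldType) (E : choiceType).
Local Notation M := {malg K[magma E]}.
Implicit Types (x y z : M).

Definition magma_mul : M -> M -> M := bilin_ext (fun u v => << MMul u v >>).

Variant lie_rel : M -> Prop :=
| LieAlt x : lie_rel (magma_mul x x)
| LieJacobi x y z :
    lie_rel (magma_mul x (magma_mul y z) + magma_mul y (magma_mul z x)
             + magma_mul z (magma_mul x y)).

Definition free_lie : Type := lquot (ideal_sub magma_mul lie_rel).
HB.instance Definition _ := GRing.Lmodule.on free_lie.

Definition free_lie_pi : M -> free_lie := @lpi K M (ideal_sub magma_mul lie_rel).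
HB.instance Definition _ := GRing.Linear.on free_lie_pi.

Definition lie_gen (a : E) : free_lie := free_lie_pi << MVar a >>.

End FreeLie.

HB.lock Definition lie (K : fieldType) (E : choiceType)
    (p q : free_lie K E) : free_lie K E :=
  free_lie_pi (magma_mul (repr p) (repr q)).

Section FreeLieTheory.
Variables (K : fieldType) (E : choiceType).
Local Notation M := {malg K[magma E]}.
Local Notation magma_mul := (@magma_mul K E).
Local Notation lie_rel := (@lie_rel K E).
Local Notation free_lie := (free_lie K E).
Local Notation free_lie_pi := (@free_lie_pi K E).
Local Notation lie := (@lie K E).
Implicit Types (x y z : M) (p q r : free_lie).

Local Notation J := (ideal_gen magma_mul lie_rel).

Lemma magma_mulDl x x' y : magma_mul (x + x') y = magma_mul x y + magma_mul x' y.
Proof. exact: bilin_extDl. Qed.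

Lemma magma_mulZl c x y : magma_mul (c *: x) y = c *: magma_mul x y.
Proof. exact: bilin_extZl. Qed.

Lemma magma_mul0l x : magma_mul 0 x = 0.
Proof. exact: bilin_ext0l. Qed.

Lemma magma_mulDr x y y' : magma_mul x (y + y') = magma_mul x y + magma_mul x y'.
Proof. exact: linearD. Qed.

Lemma magma_mulZr c x y : magma_mul x (c *: y) = c *: magma_mul x y.
Proof. exact: linearZ. Qed.

Lemma magma_mul0r x : magma_mul x 0 = 0.
Proof. exact: linear0. Qed.

Lemma magma_mulBl x x' y : magma_mul (x - x') y = magma_mul x y - magma_mul x' y.
Proof. by rewrite magma_mulDl -[- x']scaleN1r magma_mulZl scaleN1r. Qed.

Lemma magma_mulBr x y y' : magma_mul x (y - y') = magma_mul x y - magma_mul x y'.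
Proof. exact: linearB. Qed.

Lemma free_lie_piK p : free_lie_pi (repr p) = p.
Proof. exact: lpiK. Qed.

Lemma free_lie_pi_eqP x y : free_lie_pi x = free_lie_pi y <-> J (x - y).
Proof. exact: lpi_eqP. Qed.

Lemma lie_pi x y : lie (free_lie_pi x) (free_lie_pi y) = free_lie_pi (magma_mul x y).
Proof.
rewrite lie.unlock; apply/free_lie_pi_eqP; set x' := repr _; set y' := repr _.
have -> : magma_mul x' y' - magma_mul x y =
    magma_mul (x' - x) y' + magma_mul x (y' - y).
  by rewrite magma_mulBl magma_mulBr addrA subrK.
by apply: IdealD; [apply: IdealMr|apply: IdealMl]; apply/free_lie_pi_eqP;
  rewrite free_lie_piK.
Qed.

Lemma free_lie_piP c x y :
  free_lie_pi (c *: x + y) = c *: free_lie_pi x + free_lie_pi y.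
Proof. exact: linearP. Qed.

Fact lie_is_linearr p : linear (lie p).
Proof.
move=> c q r; rewrite -[p]free_lie_piK -[q]free_lie_piK -[r]free_lie_piK.
rewrite !lie_pi -[RHS]free_lie_piP -magma_mulZr -magma_mulDr -lie_pi.
by congr (lie _ _); rewrite -free_lie_piP.
Qed.

Fact lie_is_linearl q : linear (lie ^~ q).
Proof.
move=> c p r; rewrite -[p]free_lie_piK -[q]free_lie_piK -[r]free_lie_piK.
rewrite !lie_pi -[RHS]free_lie_piP -magma_mulZl -magma_mulDl -lie_pi.
by congr (lie _ _); rewrite -free_lie_piP.
Qed.

Lemma lieZl c p q : lie (c *: p) q = c *: lie p q.
Proof.
rewrite -[p]free_lie_piK -[q]free_lie_piK -linearZ !lie_pi.
by rewrite magma_mulZl linearZ.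
Qed.

Lemma lie_alternating p : lie p p = 0.
Proof.
rewrite -[p]free_lie_piK lie_pi.
by apply/lpi_eq0; apply: IdealGen; apply: LieAlt.
Qed.

Lemma lie_jacobi p q r :
  lie p (lie q r) + lie q (lie r p) + lie r (lie p q) = 0.
Proof.
rewrite -[p]free_lie_piK -[q]free_lie_piK -[r]free_lie_piK !lie_pi -!linearD.
by apply/lpi_eq0; apply: IdealGen; apply: LieJacobi.
Qed.

Variable deg : E -> nat.

Definition lie_homog (n : nat) (p : free_lie) : Prop :=
  exists2 x : M, {in msupp x, forall u, magma_degree deg u = n}
               & p = free_lie_pi x.

Definition magma_invdeg : M -> M :=
  lin_ext (fun u => (magma_degree deg u)%:R^-1 *: << u >>).
HB.instance Definition _ := GRing.Linear.on magma_invdeg.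

Definition lie_invdeg (p : free_lie) : free_lie :=
  free_lie_pi (magma_invdeg (repr p)).

(** [lie_prelie p q] is [lie p q] divided by the degree of [p] when [p] is
    homogeneous, extended bilinearly: see [lie_prelie_homog],
    [lie_prelie_is_linearl] and [lie_prelie_is_linearr]. *)
Definition lie_prelie (p q : free_lie) : free_lie := lie (lie_invdeg p) q.

(* The ideal is stable under every map acting on each degree by a scalar. *)
Let dscale (f : nat -> K) : M -> M :=
  lin_ext (fun u => f (magma_degree deg u) *: << u >>).

Let dscaleU f u : dscale f << u >> = f (magma_degree deg u) *: << u >>.
Proof. exact: lin_extU. Qed.

Let dscale0 f : dscale f 0 = 0.
Proof. exact: linear0. Qed.

Let dscaleD f x y : dscale f (x + y) = dscale f x + dscale f y.
Proof. exact: linearD. Qed.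

Let dscaleZ f c x : dscale f (c *: x) = c *: dscale f x.
Proof. exact: linearZ. Qed.

Let shift (f : nat -> K) u (n : nat) := f (magma_degree deg u + n)%N.

Let mulUU u v : magma_mul << u >> << v >> = << MMul u v >>.
Proof. exact: bilin_extUU. Qed.

Let dscale_mulUl f u y : dscale f (magma_mul << u >> y) =
  magma_mul << u >> (dscale (shift f u) y).
Proof.
elim/malg_ind: y => [|c v y IH]; first by rewrite !(magma_mul0r, dscale0).
rewrite !(magma_mulDr, magma_mulZr, dscaleD, dscaleZ) {}IH mulUU !dscaleU.
by rewrite magma_mulZr mulUU.
Qed.

Let dscale_mulUr f u y : dscale f (magma_mul y << u >>) =
  magma_mul (dscale (shift f u) y) << u >>.
Proof.
elim/malg_ind: y => [|c v y IH]; first by rewrite !(magma_mul0l, dscale0).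
rewrite !(magma_mulDl, magma_mulZl, dscaleD, dscaleZ) {}IH mulUU !dscaleU /=.
by rewrite magma_mulZl mulUU /shift addnC.
Qed.

Let ideal_swap x y : J (magma_mul x y + magma_mul y x).
Proof.
have alt z : J (magma_mul z z) by apply: IdealGen; apply: LieAlt.
have -> : magma_mul x y + magma_mul y x =
    magma_mul (x + y) (x + y) + -1 *: (magma_mul x x + magma_mul y y).
  rewrite magma_mulDl !magma_mulDr scaleN1r [magma_mul y x + _]addrC.
  by rewrite addrACA [RHS]addrAC subrr add0r.
by apply: IdealD => //; apply: IdealZ; apply: IdealD.
Qed.

Let add3ACA (a a' b b' c c' : M) :
  (a + a') + (b + b') + (c + c') = (a + b + c) + (a' + b' + c').
Proof. by rewrite (addrACA a) (addrACA (a + b)). Qed.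

Let jac x y z := magma_mul x (magma_mul y z) + magma_mul y (magma_mul z x)
             + magma_mul z (magma_mul x y).

Let jac_rot x y z : jac x y z = jac y z x.
Proof. by rewrite /jac -addrA addrC. Qed.

Let jacP c x x' y z : jac (c *: x + x') y z = c *: jac x y z + jac x' y z.
Proof.
rewrite /jac !(magma_mulDl, magma_mulDr, magma_mulZl, magma_mulZr) !scalerDr.
exact: add3ACA.
Qed.

Let ideal_dscale_jac f x y z : J (dscale f (jac x y z)).
Proof.
elim/malg_ind: x => [|c u x IH].
  rewrite /jac !(magma_mul0l, magma_mul0r, dscale0, addr0); exact: Ideal0.
rewrite jacP dscaleD dscaleZ; apply: IdealD => //; apply: IdealZ => {c x IH}.
rewrite jac_rot; elim/malg_ind: y => [|c v y IH].
  rewrite /jac !(magma_mul0l, magma_mul0r, dscale0, addr0); exact: Ideal0.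
rewrite jacP dscaleD dscaleZ; apply: IdealD => //; apply: IdealZ => {c y IH}.
rewrite jac_rot; elim/malg_ind: z => [|c w z IH].
  rewrite /jac !(magma_mul0l, magma_mul0r, dscale0, addr0); exact: Ideal0.
rewrite jacP dscaleD dscaleZ; apply: IdealD => //; apply: IdealZ => {c z IH}.
have -> : dscale f (jac << w >> << u >> << v >>) =
    f (magma_degree deg w + (magma_degree deg u + magma_degree deg v))%N *:
    jac << w >> << u >> << v >>.
  set n := (_ + (_ + _))%N.
  have dscaleE t : magma_degree deg t = n -> dscale f << t >> = f n *: << t >>.
    by move=> tn; rewrite dscaleU tn.
  have mulUUU (a b d : magma E) :
      magma_mul << a >> (magma_mul << b >> << d >>) = << MMul a (MMul b d) >>.
    by rewrite !mulUU.
  rewrite /jac !mulUUU.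
  rewrite (dscaleD f (<< _ >> + << _ >>) << _ >>) (dscaleD f << _ >> << _ >>).
  rewrite [RHS]scalerDr scalerDr.
  apply: (congr2 +%R); first apply: (congr2 +%R); apply: dscaleE => //=.
    by rewrite addnA addnC.
  by rewrite addnCA (addnC (magma_degree deg v)).
by apply: IdealZ; apply: IdealGen; apply: LieJacobi.
Qed.

Let ideal_dscale x : J x -> forall f, J (dscale f x).
Proof.
elim=> {x} [x [{}x|{}x y z] f|f|x y _ IHx _ IHy f|c x _ IH f|a x _ IH f
           |a x _ IH f].
- elim/malg_ind: x => [|c u x IH].
    by rewrite magma_mul0l dscale0; apply: Ideal0.
  have -> : magma_mul (c *: << u >> + x) (c *: << u >> + x) =
      (c * c) *: << MMul u u >>
      + (c *: (magma_mul << u >> x + magma_mul x << u >>) + magma_mul x x).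
    rewrite magma_mulDl !magma_mulDr !(magma_mulZl, magma_mulZr) mulUU scalerA.
    rewrite scalerDr -[LHS]addrA; congr (_ + _); exact: addrA.
  rewrite dscaleD dscaleZ; apply: IdealD.
    rewrite dscaleU -mulUU; apply: IdealZ; apply: IdealZ; apply: IdealGen.
    exact: LieAlt.
  rewrite dscaleD dscaleZ; apply: IdealD; last exact: IH.
  by rewrite dscaleD dscale_mulUl dscale_mulUr; apply/IdealZ/ideal_swap.
- exact: ideal_dscale_jac.
- by rewrite dscale0; apply: Ideal0.
- by rewrite dscaleD; apply: IdealD.
- by rewrite dscaleZ; apply: IdealZ.
- elim/malg_ind: a => [|c u a IHa].
    by rewrite magma_mul0l dscale0; apply: Ideal0.
  rewrite magma_mulDl magma_mulZl dscaleD dscaleZ; apply: IdealD => //.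
  by rewrite dscale_mulUl; apply/IdealZ/IdealMl.
- elim/malg_ind: a => [|c u a IHa].
    by rewrite magma_mul0r dscale0; apply: Ideal0.
  rewrite magma_mulDr magma_mulZr dscaleD dscaleZ; apply: IdealD => //.
  by rewrite dscale_mulUr; apply/IdealZ/IdealMr.
Qed.

Lemma lie_invdeg_pi x :
  lie_invdeg (free_lie_pi x) = free_lie_pi (magma_invdeg x).
Proof.
apply/free_lie_pi_eqP; rewrite -linearB.
apply: (ideal_dscale _ (fun n => n%:R^-1)).
by apply/free_lie_pi_eqP; rewrite free_lie_piK.
Qed.

Fact lie_invdeg_is_linear : linear lie_invdeg.
Proof.
move=> c p q; rewrite -[p]free_lie_piK -[q]free_lie_piK.
rewrite !lie_invdeg_pi -[RHS]free_lie_piP.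
apply: etrans (congr1 free_lie_pi (linearP magma_invdeg _ _ _)).
by rewrite -lie_invdeg_pi free_lie_piP.
Qed.

Fact lie_prelie_is_linearl q : linear (lie_prelie ^~ q).
Proof.
by move=> c p r; rewrite /lie_prelie lie_invdeg_is_linear lie_is_linearl.
Qed.

Fact lie_prelie_is_linearr p : linear (lie_prelie p).
Proof. by move=> c q r; rewrite /lie_prelie lie_is_linearr. Qed.

Lemma lie_prelie_homog n p q : lie_homog n p ->
  lie_prelie p q = n%:R^-1 *: lie p q.
Proof.
case=> x xn ->; rewrite /lie_prelie lie_invdeg_pi.
have -> : magma_invdeg x = n%:R^-1 *: x.
  rewrite {2}[x]monalgE /magma_invdeg lin_ext.unlock scaler_sumr.
  apply: eq_big_seq => u /xn ->.
  by rewrite [in RHS]malgZU !scalerA mulrC.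
by rewrite linearZ lieZl.
Qed.

End FreeLieTheory.

(* Main.v *)
Require Import Defs.
From HB Require Import structures.
From mathcomp Require Import all_boot all_order all_algebra.
From mathcomp Require Import ring zify.
From mathcomp.multinomials Require Import monalg.

(** Write [s -> t] for grafting, [D] for the linear map multiplying each tree by
    its degree and [I] for the ideal of the theorem. The idea is to carry the Lie
    bracket of the free Lie algebra back to trees. As the pre-Lie product of the
    Lie algebra is the bracket divided by the degree of its first argument, the
    bracket of two linear combinations of trees has to be [{x, y} = D x -> y].

    The generators of [I] are the sums [{s, t} + {t, s}] for trees [s] and [t],
    so this bracket is antisymmetric modulo [I], hence alternating because 2 is
    invertible. It also satisfies the Jacobi identity modulo [I]
    ([tree_bracket_jacobi]): this is the pre-Lie identity of grafting
    ([graft_prelie]), combined with the fact that [D] is a derivation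
    ([tree_eulerop_graft]). So the linear map [ev] ([magma_to_tree]) which
    interprets nonassociative monomials in [E] with this bracket sends the ideal
    of the Lie relations into [I] ([magma_to_tree_ideal]).

    As trees are generated by the one-vertex trees under grafting
    ([tree_generation]) and degrees are invertible, every [x] is congruent to
    some [ev m] modulo [I] ([magma_to_tree_surj]). Moreover [Phi (ev m)] is the
    class of [m] in the free Lie algebra ([Phi_magma_to_tree]), and [Phi] sends
    [{x, y}] to the Lie bracket of [Phi x] and [Phi y] ([Phi_tree_bracket]), so
    that it kills [I]. If now [Phi x = 0] and [x] is congruent to [ev m], the
    class of [m] is [Phi (ev m) = Phi x = 0], so [m] is in the ideal of the Lie
    relations; therefore [ev m], and with it [x], is in [I]. *)

Set Implicit Arguments.
Unset Strict Implicit.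
Unset Printing Implicit Defensive.

Import GRing.Theory.
Local Open Scope ring_scope.
Local Open Scope quotient_scope.

(** * Grafting of planar trees *)

Section PlanarGrafting.
Variable E : eqType.
Implicit Types (s t u : ptree E) (l m : seq (ptree E)).

Definition pgrafts s t := [seq pgraft_at s v t | v <- pvertices t].

(** The graftings of [s] at the vertices of the trees of the forest [l]. With
    this recursion on forests, identities on [pgrafts] are proved by structural
    induction, without the addresses of the vertices. *)
Fixpoint fgrafts s l : seq (seq (ptree E)) :=
  if l is t :: l' then
    [seq c :: l' | c <- pgrafts s t] ++ [seq t :: m | m <- fgrafts s l']
  else [::].

Lemma pgrafts_node s a l :
  pgrafts s (PNode a l) = PNode a (s :: l) :: [seq PNode a m | m <- fgrafts s l].
Proof.
rewrite /pgrafts; set x0 := PNode a l.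
rewrite {2}/x0 /=; congr cons; rewrite map_flatten -map_comp.
(* A forest starts at the index [size l0] once a prefix [l0] is skipped. *)
suff H l0 l1 : flatten [seq [seq set_nth x0 (l0 ++ l1) p.1
        (pgraft_at s v (nth x0 (l0 ++ l1) p.1)) | v <- p.2]
      | p <- zip (iota (size l0) (size l1)) (map (@pvertices E) l1)]
    = [seq l0 ++ m | m <- fgrafts s l1].
  have := H [::] l => /= H0.
  have -> : [seq PNode a m | m <- fgrafts s l] =
      [seq PNode a m | m <- [seq [::] ++ m | m <- fgrafts s l]].
    by rewrite -map_comp.
  rewrite -{}H0 map_flatten -map_comp; congr flatten; apply: eq_map => p /=.
  by rewrite -!map_comp.
elim: l1 l0 => [|t l1 IH] l0 //=.
rewrite map_cat -!map_comp; congr (_ ++ _).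
  apply: eq_map => v /=; rewrite nth_cat ltnn subnn /=.
  by elim: l0 => //= x l0 ->.
have := IH (rcons l0 t); rewrite size_rcons cat_rcons => ->.
by apply: eq_map => m; rewrite cat_rcons.
Qed.

Lemma pdegree_pgrafts (deg : E -> nat) s t c : c \in pgrafts s t ->
  pdegree deg c = (pdegree deg s + pdegree deg t)%N.
Proof.
elim/ptree_ind_mem: t c => a l IH c.
rewrite pgrafts_node inE => /predU1P[->|/mapP[m mP ->]] /=.
  by rewrite addnCA.
suff -> : sumn (map (pdegree deg) m) =
    (pdegree deg s + sumn (map (pdegree deg) l))%N by rewrite addnCA.
elim: l IH m mP => //= t l IHl IH m.
rewrite mem_cat => /orP[] /mapP[d dP ->] /=.
  by rewrite (IH t) ?mem_head // addnA.
have IH' : {in l, forall u c, c \in pgrafts s u ->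
    pdegree deg c = (pdegree deg s + pdegree deg u)%N}.
  by move=> u ul; apply: IH; rewrite inE ul orbT.
by rewrite (IHl IH' _ dP) addnCA.
Qed.

Lemma size_fgrafts s l m : m \in fgrafts s l -> size m = size l.
Proof.
elim: l m => //= t l IH m.
by rewrite mem_cat => /orP[] /mapP[d dP ->] //=; rewrite (IH d).
Qed.

Section PreLie.
Variable R : comPzRingType.

Let sumT (f : ptree E -> R) s a l : \sum_(d <- pgrafts s (PNode a l)) f d =
  f (PNode a (s :: l)) + \sum_(m <- fgrafts s l) f (PNode a m).
Proof. by rewrite pgrafts_node big_cons big_map. Qed.

Let sumF (g : seq (ptree E) -> R) s t l : \sum_(m <- fgrafts s (t :: l)) g m =
  \sum_(c <- pgrafts s t) g (c :: l) + \sum_(m <- fgrafts s l) g (t :: m).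
Proof. by rewrite big_cat !big_map. Qed.

Let sumTT (f : ptree E -> R) s u a l :
  \sum_(c <- pgrafts u (PNode a l)) \sum_(d <- pgrafts s c) f d =
  f (PNode a [:: s, u & l]) + (\sum_(c <- pgrafts s u) f (PNode a (c :: l))
                               + \sum_(m <- fgrafts s l) f (PNode a (u :: m)))
  + (\sum_(m <- fgrafts u l) f (PNode a (s :: m))
     + \sum_(m <- fgrafts u l) \sum_(m' <- fgrafts s m) f (PNode a m')).
Proof.
rewrite sumT sumT sumF -big_split; congr (_ + _).
by apply: eq_bigr => m _; rewrite sumT.
Qed.

Let sumTG (f : ptree E -> R) (r : seq (ptree E)) a l :
  \sum_(c <- r) \sum_(d <- pgrafts c (PNode a l)) f d =
  \sum_(c <- r) f (PNode a (c :: l))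
  + \sum_(c <- r) \sum_(m <- fgrafts c l) f (PNode a m).
Proof. by rewrite -big_split; apply: eq_bigr => c _; rewrite sumT. Qed.

Let sumFG (g : seq (ptree E) -> R) (r : seq (ptree E)) t l :
  \sum_(c <- r) \sum_(m <- fgrafts c (t :: l)) g m =
  \sum_(c <- r) \sum_(d <- pgrafts c t) g (d :: l)
  + \sum_(c <- r) \sum_(m <- fgrafts c l) g (t :: m).
Proof. by rewrite -big_split; apply: eq_bigr => c _; rewrite sumF. Qed.

Let sumFF (g : seq (ptree E) -> R) s u t l :
  \sum_(m <- fgrafts u (t :: l)) \sum_(m' <- fgrafts s m) g m' =
  \sum_(c <- pgrafts u t) \sum_(d <- pgrafts s c) g (d :: l)
  + \sum_(c <- pgrafts u t) \sum_(m <- fgrafts s l) g (c :: m)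
  + (\sum_(c <- pgrafts s t) \sum_(m <- fgrafts u l) g (c :: m)
     + \sum_(m <- fgrafts u l) \sum_(m' <- fgrafts s m) g (t :: m')).
Proof.
rewrite sumF -big_split (exchange_big_dep xpredT) //= -big_split.
by congr (_ + _); apply: eq_bigr => m _; rewrite sumF.
Qed.

(** Grafting [s] on [u -> t] either grafts [s] on the part [u], which gives
    [(s -> u) -> t], or grafts [s] and [u] independently at two vertices of [t],
    which is symmetric in [s] and [u]. When the two vertices are the same vertex,
    the symmetry exchanges the first two children of this vertex: this is where
    non-planarity is needed, and why [f] has to be invariant. *)
Lemma pgrafts_prelie (f : ptree E -> R) s u t :
    (forall t1 t2, ptree_iso t1 t2 -> f t1 = f t2) ->
  \sum_(c <- pgrafts u t) \sum_(d <- pgrafts s c) f d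
  + \sum_(c <- pgrafts u s) \sum_(d <- pgrafts c t) f d
  = \sum_(c <- pgrafts s t) \sum_(d <- pgrafts u c) f d
  + \sum_(c <- pgrafts s u) \sum_(d <- pgrafts c t) f d.
Proof.
have iso_refl l : all2 (@ptree_iso E) l l.
  by elim: l => //= x l ->; rewrite ptree_iso_refl.
elim/ptree_ind_mem: t f => a l IH f fP.
pose g m := f (PNode a m).
have gP m1 m2 : all2 (@ptree_iso E) m1 m2 -> g m1 = g m2.
  move=> m12; apply: fP; apply/(ptree_isoP a m1 a m2).
  by split=> //; exists m2.
have gC : g [:: s, u & l] = g [:: u, s & l].
  apply: fP; apply/(ptree_isoP a [:: s, u & l] a [:: u, s & l]).
  split=> //; exists [:: s, u & l]; last exact: iso_refl.
  exact: (introT permPl (perm_catCA [:: s] [:: u] l)).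
have forest : \sum_(m <- fgrafts u l) \sum_(d <- fgrafts s m) g d
    + \sum_(c <- pgrafts u s) \sum_(d <- fgrafts c l) g d
  = \sum_(m <- fgrafts s l) \sum_(d <- fgrafts u m) g d
    + \sum_(c <- pgrafts s u) \sum_(d <- fgrafts c l) g d.
  elim: l g gP IH {gC fP} => [|t l IHl] h hP IH; first by
    rewrite /= !big_nil; congr (_ + _); rewrite !big1 // => c _; apply: big_nil.
  have sub : {subset l <= t :: l} by move=> v vl; rewrite inE vl orbT.
  have htP m1 m2 : all2 (@ptree_iso E) m1 m2 -> h (t :: m1) = h (t :: m2).
    by move=> m12; apply: hP; rewrite /= ptree_iso_refl.
  have hlP t1 t2 : ptree_iso t1 t2 -> h (t1 :: l) = h (t2 :: l).
    by move=> t12; apply: hP; rewrite /= t12 iso_refl.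
  have {IHl sub htP} := IHl _ htP (sub_in1 sub IH).
  have {IH hlP} := IH t (mem_head _ _) _ hlP.
  rewrite !sumFF !sumFG /= => /(canRL (addrK _)) IHt /(canRL (addrK _)) IHl.
  ring: IHt IHl.
move/(canRL (addrK _)): forest => forest.
rewrite !sumTT !sumTG -!/(g _); ring: gC forest.
Qed.
End PreLie.
End PlanarGrafting.

(** * The pre-Lie algebra of trees *)

Section LinearMaps.
Variables (K : fieldType) (V : lmodType K).

Lemma malg_linear_eq (A : choiceType) (f g : {malg K[A]} -> V) :
    linear f -> linear g ->
  (forall a, f << a >> = g << a >>) -> f =1 g.
Proof.
have lin0 (h : {malg K[A]} -> V) : linear h -> h 0 = 0.
  by move=> /(_ (-1) 0 0); rewrite !scaleN1r oppr0 addr0 addNr.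
move=> fP gP fg; elim/malg_ind => [|c a x IH]; first by rewrite !lin0.
by rewrite fP gP fg IH.
Qed.

Lemma malg_bilinear_eq (A B : choiceType) (f g : {malg K[A]} -> {malg K[B]} -> V) :
    (forall y, linear (f^~ y)) -> (forall x, linear (f x)) ->
    (forall y, linear (g^~ y)) -> (forall x, linear (g x)) ->
    (forall a b, f << a >> << b >> = g << a >> << b >>) ->
  forall x y, f x y = g x y.
Proof.
move=> flP frP glP grP fg x y; move: x.
apply: (malg_linear_eq (flP y) (glP y)) => a; move: y.
exact: (malg_linear_eq (frP _) (grP _) (fg a)).
Qed.

Lemma lincombD (c : K) (a b a' b' : V) :
  c *: a + a' + (c *: b + b') = c *: (a + b) + (a' + b').
Proof. by rewrite scalerDr addrACA. Qed.
End LinearMaps.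

Section TreeAlgebra.
Variables (K : fieldType) (E : choiceType).
Local Notation T := {malg K[tree E]}.
Local Notation graft := (@graft K E).
Local Notation "<| t |>" := (<< \pi_(tree E) t >> : T) (format "<| t |>").
Implicit Types (x y z : T).

Lemma graftDl x x' y : graft (x + x') y = graft x y + graft x' y.
Proof. exact: bilin_extDl. Qed.

Lemma graftZl c x y : graft (c *: x) y = c *: graft x y.
Proof. exact: bilin_extZl. Qed.

Lemma graft0l y : graft 0 y = 0.
Proof. exact: bilin_ext0l. Qed.

Lemma graftDr x y y' : graft x (y + y') = graft x y + graft x y'.
Proof. exact: linearD. Qed.

Lemma graftZr c x y : graft x (c *: y) = c *: graft x y.
Proof. exact: linearZ. Qed.

Lemma graft0r x : graft x 0 = 0.
Proof. exact: linear0. Qed.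

Lemma graftNl x y : graft (- x) y = - graft x y.
Proof. by rewrite -scaleN1r graftZl scaleN1r. Qed.

Lemma graftNr x y : graft x (- y) = - graft x y.
Proof. exact: linearN. Qed.

Lemma graftBl x x' y : graft (x - x') y = graft x y - graft x' y.
Proof. by rewrite graftDl graftNl. Qed.

Lemma graftBr x y y' : graft x (y - y') = graft x y - graft x y'.
Proof. exact: linearB. Qed.

Lemma graft_suml (I : Type) (r : seq I) (F : I -> T) y :
  graft (\sum_(i <- r) F i) y = \sum_(i <- r) graft (F i) y.
Proof.
elim: r => [|i r IH]; first by rewrite !big_nil graft0l.
by rewrite !big_cons graftDl IH.
Qed.

Lemma graft_sumr (I : Type) (r : seq I) (F : I -> T) x :
  graft x (\sum_(i <- r) F i) = \sum_(i <- r) graft x (F i).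
Proof. exact: linear_sum. Qed.

Lemma graft_trees (s t : ptree E) :
  graft <|s|> <|t|> = \sum_(c <- pgrafts s t) <|c|>.
Proof. by rewrite /Defs.graft bilin_extUU tree_graft_pi big_map. Qed.

Lemma tree_span (P : T -> Prop) :
    P 0 -> (forall c x y, P x -> P y -> P (c *: x + y)) ->
    (forall t : ptree E, P <|t|>) ->
  forall x, P x.
Proof.
move=> P0 PD Pt; elim/malg_ind => // c b x; apply: PD.
by rewrite -[b]reprK.
Qed.

Let lincomb_eq (V : lmodType K) (c : K) (a b d e a' b' d' e' : V) :
    a + b = d + e -> a' + b' = d' + e' ->
  (c *: a + a') + (c *: b + b') = (c *: d + d') + (c *: e + e').
Proof. by move=> abde abde'; rewrite !lincombD abde abde'. Qed.

(** By trilinearity it is enough to compare coefficients on trees, where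
    [pgrafts_prelie] applies. *)
Lemma graft_prelie x y z :
  graft x (graft y z) + graft (graft y x) z
  = graft y (graft x z) + graft (graft x y) z.
Proof.
pose Q x y z := graft x (graft y z) + graft (graft y x) z
  = graft y (graft x z) + graft (graft x y) z.
(* With this symmetry, linearity in [x] and in [z] is enough. *)
have QC u v w : Q u v w -> Q v u w by [].
have Qx0 v w : Q 0 v w by rewrite /Q !(graft0l, graft0r).
have QxD v w c u u' : Q u v w -> Q u' v w -> Q (c *: u + u') v w.
  rewrite /Q !(graftDl, graftDr, graftZl, graftZr); exact: lincomb_eq.
have Qz0 u v : Q u v 0 by rewrite /Q !graft0r.
have QzD u v c w w' : Q u v w -> Q u v w' -> Q u v (c *: w + w').
  rewrite /Q !(graftDl, graftDr, graftZl, graftZr); exact: lincomb_eq.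
rewrite -/(Q x y z).
move: x; apply: (tree_span (Qx0 y z) (QxD y z)) => s; apply: QC.
move: y; apply: (tree_span (Qx0 _ z) (QxD _ z)) => u.
move: z; apply: (tree_span (Qz0 _ _) (@QzD _ _)) => t; rewrite /Q.
have graftE v w : graft <|v|> (graft <|w|> <|t|>) =
    \sum_(c <- pgrafts w t) \sum_(d <- pgrafts v c) <|d|>.
  apply: etrans (congr1 (graft <|v|>) (graft_trees w t)) _.
  by rewrite graft_sumr; apply: eq_bigr => c _; exact: graft_trees.
have graftEl v w : graft (graft <|v|> <|w|>) <|t|> =
    \sum_(c <- pgrafts v w) \sum_(d <- pgrafts c t) <|d|>.
  apply: etrans (congr1 (graft^~ <|t|>) (graft_trees v w)) _.
  by rewrite graft_suml; apply: eq_bigr => c _; exact: graft_trees.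
apply: etrans (congr2 +%R (graftE u s) (graftEl s u)) _.
apply: etrans _ (esym (congr2 +%R (graftE s u) (graftEl u s))).
apply/malgP => k; rewrite !mcoeffD.
have coefE (r : seq (ptree E)) (F : ptree E -> seq (ptree E)) :
    (\sum_(c <- r) \sum_(d <- F c) <|d|>)@_k =
    \sum_(c <- r) \sum_(d <- F c) <|d|>@_k.
  by rewrite raddf_sum; apply: eq_bigr => c _; rewrite raddf_sum.
rewrite !coefE; apply: pgrafts_prelie => t1 t2 /tree_eqP -> //.
Qed.

(** Grafting [s] on [PNode a l] gives [PNode a (s :: l)] plus trees with as many
    vertices but with one child less at the root, whence an induction on the
    number of vertices and then on the number of children of the root. *)
Lemma tree_generation (P : T -> Prop) :
    P 0 -> (forall c x y, P x -> P y -> P (c *: x + y)) ->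
    (forall a, P << tree_vertex a >>) ->
    (forall x y, P x -> P y -> P (graft x y)) ->
  forall x, P x.
Proof.
move=> P0 PD PE PM.
have Psub x y : P (x + y) -> P y -> P x.
  by move=> Pxy Py; have := PD (-1) _ _ Py Pxy; rewrite scaleN1r addrCA addNr addr0.
have Psum (I : eqType) (r : seq I) (F : I -> T) :
    {in r, forall i, P (F i)} -> P (\sum_(i <- r) F i).
  elim: r => [|i r IH] Pr; first by rewrite big_nil.
  rewrite big_cons -[F i]scale1r; apply: PD; first by apply/Pr/mem_head.
  by apply: IH => j jr; apply: Pr; rewrite inE jr orbT.
pose nv := pdegree (fun _ : E => 1%N).
apply: tree_span => // t; have [n] := ubnP (nv t).
elim: n t => // n IHn [a l]; have [k] := ubnP (size l).
elim: k l => // k IHk [|s l] /= lk ln; first exact: PE.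
have nvs : (nv s < n)%N.
  by move: ln; rewrite /nv /=; lia.
have := graft_trees s (PNode a l); rewrite pgrafts_node big_cons big_map => e.
apply: (@Psub _ (\sum_(m <- fgrafts s l) <|PNode a m|>)).
  rewrite -e; apply: PM; apply: IHn => //.
  have : (0 < nv s)%N by case: (s).
  by move: ln; rewrite /nv /=; lia.
apply: Psum => m mP; apply: IHk; first by rewrite (size_fgrafts mP).
have := @pdegree_pgrafts _ (fun=> 1%N) s (PNode a l) (PNode a m).
rewrite pgrafts_node inE map_f ?orbT // => /(_ isT).
by move: ln; rewrite /nv /=; lia.
Qed.
End TreeAlgebra.

(** * The degree as a derivation *)

Section DegreeDerivation.
Variables (K : fieldType) (E : choiceType) (deg : E -> nat).
Local Notation T := {malg K[tree E]}.
Local Notation M := {malg K[magma E]}.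
Local Notation graft := (@graft K E).
Implicit Types (x y z : T) (m n : M) (u : magma E).

(** The Euler operator of the grading. Written as [D] below, it replaces
    statements about homogeneous elements by linear identities valid everywhere. *)
Definition tree_eulerop : T -> T :=
  lin_ext (fun t => (tree_degree deg t)%:R *: << t >>).
HB.instance Definition _ := GRing.Linear.on tree_eulerop.

Definition magma_eulerop : M -> M :=
  lin_ext (fun u => (magma_degree deg u)%:R *: << u >>).
HB.instance Definition _ := GRing.Linear.on magma_eulerop.

(** The degree of a grafting of [s] on [t] is the sum of their degrees. *)
Lemma tree_eulerop_graft x y :
  tree_eulerop (graft x y) = graft (tree_eulerop x) y + graft x (tree_eulerop y).
Proof.
pose D := tree_eulerop; rewrite -/D.
have DP c v w : D (c *: v + w) = c *: D v + D w by exact: linearP.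
have graft_linl v c w w' :
    graft (c *: w + w') v = c *: graft w v + graft w' v.
  by rewrite graftDl graftZl.
have graft_linr v c w w' :
    graft v (c *: w + w') = c *: graft v w + graft v w'.
  by rewrite graftDr graftZr.
move: x y; apply: malg_bilinear_eq => [y c v w|x c v w|y c v w|x c v w|s t].
- by rewrite graftDl graftZl DP.
- by rewrite graftDr graftZr DP.
- by rewrite DP (graft_linl y c (D v)) (graft_linl (D y) c v); apply: lincombD.
- by rewrite DP (graft_linr x c (D v)) (graft_linr (D x) c v); apply: lincombD.
have homog c d v w : D v = c *: v -> D w = d *: w ->
    graft (D v) w + graft v (D w) = (c + d) *: graft v w.
  by move=> -> ->; rewrite graftZl graftZr scalerDl.
have DU (p : ptree E) :
    D << \pi_(tree E) p >> = (pdegree deg p)%:R *: << \pi_(tree E) p >>.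
  by rewrite /D /tree_eulerop lin_extU tree_degree_pi.
rewrite -[s]reprK -[t]reprK; move: (repr s) (repr t) => p q {s t}.
apply: etrans _ (esym (homog _ _ _ _ (DU p) (DU q))).
rewrite -natrD graft_trees scaler_sumr; apply: etrans (linear_sum D _ _ _) _.
by apply: eq_big_seq => c /(pdegree_pgrafts deg) e; rewrite [LHS]DU e.
Qed.

Lemma magma_eulerop_basis u :
  magma_eulerop << u >> = (magma_degree deg u)%:R *: << u >>.
Proof. exact: lin_extU. Qed.

Lemma magma_eulerop_mul m n : magma_eulerop (magma_mul m n) =
  magma_mul (magma_eulerop m) n + magma_mul m (magma_eulerop n).
Proof.
pose D := magma_eulerop; rewrite -/D.
have meulerP c v w : D (c *: v + w) = c *: D v + D w by exact: linearP.
have mul_linl (v : M) c (w w' : M) :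
    magma_mul (c *: w + w') v = c *: magma_mul w v + magma_mul w' v.
  by rewrite magma_mulDl magma_mulZl.
have mul_linr (v : M) c (w w' : M) :
    magma_mul v (c *: w + w') = c *: magma_mul v w + magma_mul v w'.
  by rewrite magma_mulDr magma_mulZr.
move: m n; apply: malg_bilinear_eq => [m c n p|m c n p|m c n p|m c n p|u v].
- by rewrite magma_mulDl magma_mulZl meulerP.
- by rewrite magma_mulDr magma_mulZr meulerP.
- by rewrite meulerP (mul_linl m c (D n)) (mul_linl (D m) c n); apply: lincombD.
- by rewrite meulerP (mul_linr m c (D n)) (mul_linr (D m) c n); apply: lincombD.
rewrite /D !magma_eulerop_basis magma_mulZl magma_mulZr -scalerDl.
by rewrite /magma_mul bilin_extUU magma_eulerop_basis natrD.
Qed.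
End DegreeDerivation.

(** * The Lie bracket on trees modulo the ideal *)

Section MagmaEvaluation.
Variables (K : fieldType) (charK0 : [pchar K] =i pred0).
Variables (E : choiceType) (deg : E -> nat) (deg_gt0 : forall a, (0 < deg a)%N).
Local Notation T := {malg K[tree E]}.
Local Notation M := {malg K[magma E]}.
Local Notation graft := (@graft K E).
Local Notation D := (@tree_eulerop K E deg).
Local Notation mul := (@magma_mul K E).
Local Notation mdeg := (@magma_eulerop K E deg).
Local Notation invdeg := (@magma_invdeg K E deg).
Local Notation I := (ideal_gen graft (symm_rel deg)).
Implicit Types (x y z : T) (m n p : M) (u v w : magma E).

(** For a tree [x] this is [|x| (x -> y)], the lift of the Lie bracket; it is
    denoted [{x, y}] below. *)
Definition tree_bracket x y := graft (D x) y.

(** The factor is the action of [D] on the left operand, which is homogeneous. *)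
Fixpoint tree_of_magma u : T :=
  match u with
  | MVar a => << tree_vertex a >>
  | MMul u v =>
      (magma_degree deg u)%:R *: graft (tree_of_magma u) (tree_of_magma v)
  end.

Definition magma_to_tree : M -> T := lin_ext tree_of_magma.
HB.instance Definition _ := GRing.Linear.on magma_to_tree.
Local Notation ev := magma_to_tree.

Let evU u : ev << u >> = tree_of_magma u.
Proof. exact: lin_extU. Qed.

Let evP c m n : ev (c *: m + n) = c *: ev m + ev n.
Proof. exact: linearP. Qed.

Let ev0 : ev 0 = 0.
Proof. exact: linear0. Qed.

Let DP c x y : D (c *: x + y) = c *: D x + D y.
Proof. exact: linearP. Qed.

Let D0 : D 0 = 0.
Proof. exact: linear0. Qed.

Let mdegP c m n : mdeg (c *: m + n) = c *: mdeg m + mdeg n.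
Proof. exact: linearP. Qed.

Let evZ c m : ev (c *: m) = c *: ev m.
Proof. exact: linearZ. Qed.

Let scaleC (V : lmodType K) (a b : K) (v : V) : a *: (b *: v) = b *: (a *: v).
Proof. by rewrite !scalerA mulrC. Qed.

Lemma tree_eulerop_magma u :
  D (tree_of_magma u) = (magma_degree deg u)%:R *: tree_of_magma u.
Proof.
have DZ c x : D (c *: x) = c *: D x by exact: linearZ.
elim: u => [a|u IHu v IHv] /=.
  by rewrite /tree_eulerop lin_extU tree_degree_pi /= addn0.
rewrite DZ tree_eulerop_graft IHu IHv graftZl graftZr -scalerDl -natrD.
exact: scaleC.
Qed.

Lemma magma_degree_neq0 u : (magma_degree deg u)%:R != 0 :> K.
Proof.
rewrite ((pcharf0P K).1 charK0) -lt0n.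
by elim: u => [a|u IHu v _] /=; rewrite ?deg_gt0 // addn_gt0 IHu.
Qed.

Lemma tree_eulerop_magma_to_tree m : D (ev m) = ev (mdeg m).
Proof.
move: m; apply: malg_linear_eq => [c m n|c m n|u].
- by rewrite evP DP.
- by rewrite mdegP evP.
by rewrite magma_eulerop_basis evZ evU tree_eulerop_magma.
Qed.

Lemma magma_invdeg_basis u : invdeg << u >> = (magma_degree deg u)%:R^-1 *: << u >>.
Proof. exact: lin_extU. Qed.

Let invdegP c m n : invdeg (c *: m + n) = c *: invdeg m + invdeg n.
Proof. exact: linearP. Qed.

Let mdegZ c m : mdeg (c *: m) = c *: mdeg m.
Proof. exact: linearZ. Qed.

Let invdegZ c m : invdeg (c *: m) = c *: invdeg m.
Proof. exact: linearZ. Qed.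

Lemma magma_euleropK m : invdeg (mdeg m) = m.
Proof.
move: m; apply: malg_linear_eq => // [c m n|u].
  by rewrite mdegP invdegP.
rewrite magma_eulerop_basis invdegZ magma_invdeg_basis.
by rewrite scalerA mulfV ?scale1r // magma_degree_neq0.
Qed.

Lemma magma_invdegK m : mdeg (invdeg m) = m.
Proof.
move: m; apply: malg_linear_eq => // [c m n|u].
  by rewrite invdegP mdegP.
rewrite magma_invdeg_basis mdegZ magma_eulerop_basis.
by rewrite scalerA mulVf ?scale1r // magma_degree_neq0.
Qed.

Lemma tree_bracketDl c x x' y :
  tree_bracket (c *: x + x') y = c *: tree_bracket x y + tree_bracket x' y.
Proof. by rewrite /tree_bracket DP graftDl graftZl. Qed.

Lemma tree_bracketDr c x y y' :
  tree_bracket x (c *: y + y') = c *: tree_bracket x y + tree_bracket x y'.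
Proof. by rewrite /tree_bracket graftDr graftZr. Qed.

Lemma magma_to_tree_mul m n : ev (mul m n) = tree_bracket (ev m) (ev n).
Proof.
move: m n; apply: malg_bilinear_eq => [m c n p|m c n p|m c n p|m c n p|u v].
- by rewrite magma_mulDl magma_mulZl evP.
- by rewrite magma_mulDr magma_mulZr evP.
- by rewrite evP tree_bracketDl.
- by rewrite evP tree_bracketDr.
by rewrite /magma_mul bilin_extUU !evU /tree_bracket tree_eulerop_magma graftZl.
Qed.

Let IB x y : I x -> I y -> I (x - y).
Proof. by move=> Ix Iy; rewrite -scaleN1r; apply: IdealD => //; apply: IdealZ. Qed.

Lemma tree_bracket_basis (t : tree E) y :
  tree_bracket << t >> y = (tree_degree deg t)%:R *: graft << t >> y.
Proof. by rewrite /tree_bracket /tree_eulerop lin_extU graftZl. Qed.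

Lemma tree_bracket_swap x y : I (tree_bracket x y + tree_bracket y x).
Proof.
have b0 x' : tree_bracket 0 x' + tree_bracket x' 0 = 0.
  by rewrite /tree_bracket D0 graft0l graft0r addr0.
pose Q x y := I (tree_bracket x y + tree_bracket y x).
have QC x' y' : Q x' y' -> Q y' x' by rewrite /Q addrC.
have Q0 y' : Q 0 y' by rewrite /Q b0; apply: Ideal0.
have QP y' c x1 x2 : Q x1 y' -> Q x2 y' -> Q (c *: x1 + x2) y'.
  move=> Q1 Q2; rewrite /Q tree_bracketDl tree_bracketDr lincombD.
  by apply: IdealD => //; apply: IdealZ.
rewrite -/(Q x y); move: x; apply: (tree_span (Q0 y) (QP y)) => s; apply: QC.
set b := (X in Q _ X); move: y; apply: (tree_span (Q0 b) (QP b)) => t.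
apply: IdealGen; exists (\pi_(tree E) t), (\pi_(tree E) s).
exact: (congr2 +%R (tree_bracket_basis _ _) (tree_bracket_basis _ _)).
Qed.

Lemma tree_bracket_alt x : I (tree_bracket x x).
Proof.
have two0 : 2%:R != 0 :> K by rewrite ((pcharf0P K).1 charK0).
have /(IdealZ 2%:R^-1) := tree_bracket_swap x x.
by rewrite -mulr2n -scaler_nat scalerA mulVf // scale1r.
Qed.

(** The pre-Lie identity for [D x], [D y] and [z] expresses
    [{x, {y, z}} - {y, {x, z}}] as [(D x -> D y - D y -> D x) -> z]. As [D] is a
    derivation, [{{x, y}, z} = (D (D x) -> y + D x -> D y) -> z], where modulo the
    ideal [D (D x) -> y = {D x, y}] is [- {y, D x} = - (D y -> D x)]. *)
Lemma tree_bracket_jacobi x y z :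
  I (tree_bracket x (tree_bracket y z) + tree_bracket y (tree_bracket z x)
     + tree_bracket z (tree_bracket x y)).
Proof.
pose J := ideal_sub graft (symm_rel deg); pose q := @lpi K T J.
have qP x' y' : I (x' - y') -> q x' = q y' := (lpi_eqP J x' y').2.
have qD x' y' : q (x' + y') = q x' + q y' by exact: linearD.
have Icong x' y' : q x' = q y' -> I (x' - y') := (lpi_eqP J x' y').1.
have congl x' y' z' : q x' = q y' -> q (graft x' z') = q (graft y' z').
  by move/Icong => Ixy; apply: qP; rewrite -graftBl; apply: IdealMr.
have congr x' y' z' : q x' = q y' -> q (graft z' x') = q (graft z' y').
  by move/Icong => Ixy; apply: qP; rewrite -graftBr; apply: IdealMl.
have qN x' : q (- x') = - q x' by exact: linearN.
have swap x' y' : q (graft (D x') y') = q (- graft (D y') x').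
  by apply: qP; rewrite opprK; apply: tree_bracket_swap.
apply/(lpi_eq0 J); rewrite -/(q _) /tree_bracket !qD.
rewrite (congr _ _ (D y) (swap z x)) (swap z) tree_eulerop_graft.
have -> : q (- graft (graft (D (D x)) y + graft (D x) (D y)) z) =
  q (graft (graft (D y) (D x)) z) - q (graft (graft (D x) (D y)) z).
  rewrite qN graftDl qD (congl _ _ z (swap (D x) y)).
  by rewrite graftNl qN opprD opprK.
by rewrite graftNr qN addrACA -opprD -!qD graft_prelie subrr.
Qed.

(** Modulo the ideal of trees the bracket is alternating and satisfies the Jacobi
    identity. For [x] in that ideal, [{y, x} = D y -> x] is in it as well, and
    antisymmetry gives the same for [{x, y}]. *)
Lemma magma_to_tree_ideal m : ideal_gen mul (@lie_rel K E) m -> I (ev m).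
Proof.
elim=> {m} [m [{}m|{}m n p]||m n _ IHm _ IHn|c m _ IH|n m _ IH|n m _ IH].
- by rewrite magma_to_tree_mul; apply: tree_bracket_alt.
- have evD m' n' : ev (m' + n') = ev m' + ev n' by exact: linearD.
  by rewrite !evD !magma_to_tree_mul; apply: tree_bracket_jacobi.
- by rewrite ev0; apply: Ideal0.
- by rewrite linearD; apply: IdealD.
- by rewrite linearZ; apply: IdealZ.
- by rewrite magma_to_tree_mul; apply: IdealMl.
rewrite magma_to_tree_mul -[tree_bracket _ _](addrK (tree_bracket (ev n) (ev m))).
by apply: IB; [apply: tree_bracket_swap|apply: IdealMl].
Qed.

(** The combinations [ev m] are closed under grafting: [x -> y = {x', y}] where
    [x'] is [x] with each homogeneous component divided by its degree. *)
Lemma magma_to_tree_surj x : exists m, I (x - ev m).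
Proof.
move: x; apply: tree_generation => [|c x y [m Im] [n In]|a|x y [m Im] [n In]].
- by exists 0; rewrite ev0 subr0; apply: Ideal0.
- exists (c *: m + n); rewrite evP opprD addrACA -scalerBr.
  by apply: IdealD => //; apply: IdealZ.
- by exists << MVar a >>; rewrite evU subrr; apply: Ideal0.
exists (mul (invdeg m) n).
rewrite magma_to_tree_mul /tree_bracket tree_eulerop_magma_to_tree magma_invdegK.
have -> : graft x y - graft (ev m) (ev n)
    = graft (x - ev m) y + graft (ev m) (y - ev n).
  by rewrite graftBl graftBr addrA subrK.
by apply: IdealD; [apply: IdealMr|apply: IdealMl].
Qed.

(** * The morphism to the free Lie algebra *)

Section Morphism.
Variable Phi : {linear T -> free_lie K E}.
Hypothesis PhiM : forall x y, Phi (graft x y) = lie_prelie deg (Phi x) (Phi y).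
Hypothesis PhiE : forall a, Phi << tree_vertex a >> = lie_gen K a.
Local Notation pi := (@free_lie_pi K E).

Lemma lie_prelie_pi m n : lie_prelie deg (pi m) (pi n) = pi (mul (invdeg m) n).
Proof. by rewrite /lie_prelie lie_invdeg_pi lie_pi. Qed.

Lemma Phi_tree_of_magma u : Phi (tree_of_magma u) = pi << u >>.
Proof.
elim: u => [a|u IHu v IHv] /=; first exact: PhiE.
rewrite linearZ /= PhiM IHu IHv lie_prelie_pi /magma_invdeg lin_extU.
rewrite magma_mulZl linearZ scalerA mulfV ?magma_degree_neq0 // scale1r.
by rewrite /magma_mul bilin_extUU.
Qed.

Lemma Phi_magma_to_tree m : Phi (ev m) = pi m.
Proof.
move: m; apply: malg_linear_eq => [c m n|c m n|u].
- by rewrite evP linearP.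
- exact: free_lie_piP.
by rewrite evU Phi_tree_of_magma.
Qed.

(** [Phi] preserves the grading: it intertwines [D] with the multiplication by
    the degree in the free Lie algebra. The latter is described through
    representatives [m] in the free nonassociative algebra. *)
Lemma Phi_eulerop x : exists2 m, Phi x = pi m & Phi (D x) = pi (mdeg m).
Proof.
move: x; apply: tree_generation => [|c x y [m Pm Dm] [n Pn Dn]|a
  |x y [m Pm Dm] [n Pn Dn]].
- by exists 0; rewrite ?D0 !linear0.
- by exists (c *: m + n); rewrite ?DP !linearP ?Pm ?Pn ?Dm ?Dn.
- exists << MVar a >>; first exact: PhiE.
  rewrite /magma_eulerop lin_extU /tree_eulerop lin_extU tree_degree_pi /= addn0.
  by rewrite !linearZ /= PhiE.
exists (mul (invdeg m) n); first by rewrite PhiM Pm Pn lie_prelie_pi.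
rewrite tree_eulerop_graft linearD !PhiM Pm Pn Dm Dn !lie_prelie_pi.
by rewrite magma_eulerop_mul linearD magma_invdegK magma_euleropK.
Qed.

Lemma Phi_tree_bracket x y : Phi (tree_bracket x y) = lie (Phi x) (Phi y).
Proof.
have [m Pm Dm] := Phi_eulerop x.
by rewrite PhiM /lie_prelie Dm lie_invdeg_pi magma_euleropK Pm.
Qed.

Lemma Phi_ideal x : I x -> Phi x = 0.
Proof.
have lie_swap (p q : free_lie K E) : lie p q + lie q p = 0.
  have lieDl (r s t : free_lie K E) : lie (r + s) t = lie r t + lie s t.
    by have := lie_is_linearl t 1 r s; rewrite !scale1r.
  have lieDr (r s t : free_lie K E) : lie r (s + t) = lie r s + lie r t.
    by have := lie_is_linearr r 1 s t; rewrite !scale1r.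
  have := lie_alternating (p + q); rewrite lieDl !lieDr !lie_alternating.
  by rewrite add0r addr0.
elim=> {x} [x [s [t ->]]||x y _ IHx _ IHy|c x _ IH|y x _ IH|y x _ IH].
- have Phi_sym y z : Phi (tree_bracket y z + tree_bracket z y) = 0.
    by rewrite linearD !Phi_tree_bracket lie_swap.
  apply: etrans (congr1 Phi _) (Phi_sym << s >> << t >>).
  exact: (esym (congr2 +%R (tree_bracket_basis s _) (tree_bracket_basis t _))).
- exact: linear0.
- by rewrite linearD IHx IHy addr0.
- by rewrite linearZ IH; apply: scaler0.
- rewrite PhiM IH; have := lie_prelie_is_linearr deg (Phi y) (-1) 0 0.
  by rewrite !scaleN1r oppr0 addr0 addNr.
rewrite PhiM IH; have := lie_prelie_is_linearl deg (Phi y) (-1) 0 0.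
by rewrite !scaleN1r oppr0 addr0 addNr.
Qed.

End Morphism.
End MagmaEvaluation.

Theorem proposition4
    (K : fieldType) (charK0 : [pchar K] =i pred0)
    (E : choiceType) (deg : E -> nat)
    (deg_gt0 : forall a : E, (0 < deg a)%N)
    (deg_finite : forall i : nat, exists s : seq E, forall a : E,
       deg a = i -> a \in s)
    (E_nonempty : inhabited E)
    (Phi : {linear {malg K[tree E]} -> free_lie K E})
    (PhiM : forall x y : {malg K[tree E]},
       Phi (graft x y) = lie_prelie deg (Phi x) (Phi y))
    (PhiE : forall a : E, Phi << tree_vertex a >> = lie_gen K a) :
  forall x : {malg K[tree E]},
    ideal_gen (@graft K E) (symm_rel deg) x <-> Phi x = 0.
Proof.
move=> x; split; first exact: Phi_ideal.
have [m Im] := magma_to_tree_surj charK0 deg_gt0 x.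
move=> Px0; rewrite -(subrK (magma_to_tree deg m) x); apply: IdealD => //.
apply: magma_to_tree_ideal => //; apply/(lpi_eq0 (ideal_sub _ _)).
have /(Phi_ideal charK0 deg_gt0 PhiM PhiE) := Im.
rewrite linearB Px0 (Phi_magma_to_tree charK0 deg_gt0 PhiM PhiE) sub0r.
by move/eqP; rewrite oppr_eq0 => /eqP.
Qed.
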